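(* For every $\omega\in\Omega$ and every $n\ge0$, $$\mathbb S^n_0=\left(\mathcal Q(\widetilde T^{-1}(n)),\ldots,\mathcal Q(1)\right)\circ\vartheta^n ,$$ where the right-hand side is the empty sequence $\mathbf z$ if $\widetilde T^{-1}(n)\circ\vartheta^n=0$.
   Context: Measures. $\mathcal M$ is the set of finite point measures on $(0,\infty)$, $\epsilon_x$ is the Dirac mass at $x$, $\mathbf z$ is the zero measure. For $\nu\in\mathcal M$, $|\nu|=\nu(0,\infty)$ and $\pi(\nu)$ is the supremum of its support ($\pi(\mathbf z)=0$). $\Upsilon_k(\nu)$ is obtained from $\nu$ by removing its $k$ largest atoms, counted with multiplicity ($\Upsilon_k(\nu)=\mathbf z$ if $k\ge|\nu|$). $\mathcal M^*=\bigcup_{n\ge 0}(\mathcal M\setminus\{\mathbf z\})^n$ is the set of finite sequences of non-zero measures; the empty sequence is identified with $\mathbf z$, a non-zero measure with a sequence of length one; $[Y_1,\dots,Y_N]$ denotes concatenation ($\mathbf z$ being neutral). Conventions: $\max\emptyset=-\infty$, $\inf\emptyset=+\infty$. Sticks and operators. $\mathbb L=\{(v,\nu)\in(0,\infty)\times\mathcal M: v\ge\pi(\nu)\}$ and $\Omega=\mathbb L^{\mathbb Z}$; $\omega=(\omega_n,n\in\mathbb Z)$ with $\omega_n=(V_n,\mathcal P_n)$. All quantities below are functions of $\omega$. $\theta_n(\omega)=(\omega_{n+k},k\in\mathbb Z)$ (shift), $\vartheta^n(\omega)=(\omega_{n-k-1},k\in\mathbb Z)$ (dual operator). In $X\circ\vartheta^n$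 (or $X\circ\theta_n$), everything in $X$, including random indices, is evaluated at $\vartheta^n(\omega)$ (resp. $\theta_n(\omega)$). Spine process. For $Y\in\mathcal M^*$, $\nu\in\mathcal M$, put $H=\max\{k\ge1:|Y(k)|\ge2\}$ and $\Phi(Y,\nu)=[Y,\nu]$ if $\nu\ne\mathbf z$; $\Phi(Y,\nu)=(Y(1),\dots,Y(H-1),\Upsilon_1(Y(H)))$ if $\nu=\mathbf z$ and $H\ge1$; $\Phi(Y,\nu)=\mathbf z$ otherwise. Then $\mathbb S^0_0=\mathbf z$ and $\mathbb S^{n+1}_0=\Phi(\mathbb S^n_0,\mathcal P_n)$, $n\ge0$. Lukasiewicz path. $S(0)=0$ and, for $n\ge1$, $S(n)=\sum_{k=0}^{n-1}(|\mathcal P_k|-1)$, $S(-n)=-\sum_{k=-n}^{-1}(|\mathcal P_k|-1)$. Weak ascending ladder times: $T(0)=0$, $T(k+1)=\inf\{\ell>T(k):S(\ell)\ge S(T(k))\}$ (with $T(k+1)=\infty$ if $T(k)=\infty$). $\tau_\ell=\inf\{k>0:S(k)\ge\ell\}$; if $\tau_\ell<\infty$, $\zeta_\ell=\ell-S(\tau_\ell-1)$ and $\mu_\ell=\Upsilon_{\zeta_\ell}(\mathcal P_{\tau_\ell-1})$. For $k\ge1$ with $T(k)<\infty$, $\mathcal Q(k)=\mu_0\circ\theta_{T(k-1)}$. Finally $\widetilde T^{-1}(n)=\max\{k\ge0:T(k)\le n\}$. *)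

(* Defs.v *)
From HB Require Import structures.
From mathcomp Require Import all_boot all_order all_algebra finmap multiset.
From mathcomp Require Import boolp classical_sets reals interval_inference.
From mathcomp Require Import ereal measure lebesgue_measure.

Set Implicit Arguments.
Unset Strict Implicit.
Unset Printing Implicit Defensive.

Import Order.TTheory GRing.Theory Num.Theory.

Local Open Scope mset_scope.
Local Open Scope ring_scope.

(* Infimum and maximum of a set of natural numbers, with the conventions
   inf = +oo and max = -oo on the empty set: None stands for +oo in [nat_inf]
   and for -oo in [nat_max]. *)
Definition nat_inf (P : pred nat) : option nat :=
  if pselect (exists m, P m) is left exP then Some (ex_minn exP) else None.

Definition nat_max (P : pred nat) : option nat :=
  if pselect (exists m, P m /\ forall k, P k -> (k <= m)%N) is left exP
  then Some (projT1 (cid exP)) else None.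

Section SpineProcess.
Context {R : realType}.

(* A finite point measure on (0, oo) is the finite multiset of its atoms:
   [nu x] is the mass of the singleton {x} and [size nu] is the total mass.
   [dirac_sum] is the underlying measure; see [dirac_sum_inj] and
   [dirac_sum_mass]. *)
Local Notation pmeas := {mset {posnum R}}.

Definition dirac_sum (nu : pmeas) (A : set R) : \bar R :=
  (\sum_(x <- nu) \d_(x%:num) A)%E.

Lemma dirac_sumE (nu : pmeas) (A : set R) :
  dirac_sum nu A = (count (fun x : {posnum R} => x%:num \in A) nu)%:R%:E.
Proof.
rewrite /dirac_sum; elim: (nu : seq _) => [|x s IHs] /=; first by rewrite big_nil.
by rewrite big_cons IHs diracE natrD EFinD.
Qed.

Lemma dirac_sum_inj (nu nu' : pmeas) :
  (forall A : set R, measurable A -> dirac_sum nu A = dirac_sum nu' A) ->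
  nu = nu'.
Proof.
move=> eq_nu; apply/msetP => x.
have := eq_nu [set x%:num]%classic (measurable_set1 _).
have countE (m : pmeas) : 
    count (fun y : {posnum R} => y%:num \in [set x%:num]%classic) m = m x.
  rewrite -count_mem_mset; apply: eq_count => y /=.
  apply/idP/eqP => [|->]; last exact/mem_set.
  by move=> /set_mem /= /val_inj.
by rewrite !dirac_sumE !countE => -[] /eqP; rewrite eqr_nat => /eqP.
Qed.

Lemma dirac_sum_mass (nu : pmeas) :
  dirac_sum nu [set x : R | 0 < x]%classic = (size nu)%:R%:E.
Proof.
rewrite dirac_sumE -[in RHS](count_predT nu); congr (_ %:R%:E).
by apply: eq_count => x /=; apply/mem_set => /=.
Qed.

(* [sup] of the empty set is 0, so [supp_sup mset0 = 0]. *)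
Definition supp_sup (nu : pmeas) : R :=
  sup [set x%:num | x in [set x : {posnum R} | x \in nu]]%classic.

Definition Upsilon (k : nat) (nu : pmeas) : pmeas :=
  seq_mset (drop k (sort >=%R nu)).

Definition nzpmeas := {nu : pmeas | nu != mset0}.
Definition pmeas_seq := seq nzpmeas.

(* The identification of measures with sequences of length at most one:
   the zero measure is sent to [::] and any other nu to [:: nu]. *)
Definition to_seq (nu : pmeas) : pmeas_seq := pmap insub [:: nu].

(* Y(k), for 1 <= k <= size Y *)
Definition entry (Y : pmeas_seq) (k : nat) : pmeas :=
  nth mset0 [seq val nu | nu <- Y] k.-1.

Definition height (Y : pmeas_seq) : option nat :=
  nat_max [pred k | (1 <= k <= size Y)%N && (2 <= size (entry Y k))%N].

Definition Phi (Y : pmeas_seq) (nu : pmeas) : pmeas_seq :=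
  if nu != mset0 then Y ++ to_seq nu
  else if height Y is Some h
       then take h.-1 Y ++ to_seq (Upsilon 1 (entry Y h))
       else [::].

Definition stick := {x : {posnum R} * pmeas | supp_sup x.2 <= x.1%:num}.

Definition Omega := int -> stick.

Implicit Type w : Omega.

Definition stick_V w (n : int) : {posnum R} := (val (w n)).1.
Definition stick_P w (n : int) : pmeas := (val (w n)).2.

Definition theta (n : int) w : Omega := fun k => w (n + k).
Definition vartheta (n : int) w : Omega := fun k => w (n - k - 1).

Fixpoint spine w (n : nat) : pmeas_seq :=
  if n is m.+1 then Phi (spine w m) (stick_P w m%:Z) else [::].

(* [Negz m] is the integer - m.+1. *)
Definition luka w (n : int) : int :=
  match n with
  | Posz m => \sum_(0 <= k < m) ((size (stick_P w k%:Z))%:Z - 1)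
  | Negz m =>
      - \sum_(0 <= k < m.+1) ((size (stick_P w (- m.+1%:Z + k%:Z)))%:Z - 1)
  end.

(* T(k), with None for +oo *)
Fixpoint ladder w (k : nat) : option nat :=
  if k is j.+1 then
    if ladder w j is Some t
    then nat_inf [pred l | (t < l)%N && (luka w t%:Z <= luka w l%:Z)]
    else None
  else Some 0%N.

Definition tau w (l : nat) : option nat :=
  nat_inf [pred k | (0 < k)%N && (l%:Z <= luka w k%:Z)].

(* zeta_l, when tau_l = t < oo *)
Definition zeta w (l t : nat) : int := l%:Z - luka w (t%:Z - 1).

(* The value mset0 when tau_l = oo is a dummy one. For l >= 0, zeta_l is
   nonnegative, so the absolute value is only a cast to nat. *)
Definition mu w (l : nat) : pmeas :=
  if tau w l is Some t then Upsilon `|zeta w l t|%N (stick_P w (t%:Z - 1))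
  else mset0.

(* For k >= 1; the value mset0 when T(k) = oo is a dummy one. *)
Definition ladder_Q w (k : nat) : pmeas :=
  if ladder w k.-1 is Some t then mu (theta t%:Z w) 0 else mset0.

(* The set contains 0 and is bounded by n because k <= T(k), so the maximum is
   finite. *)
Definition ladder_inv w (n : nat) : nat :=
  odflt 0%N
    (nat_max [pred k | if ladder w k is Some t then (t <= n)%N else false]).

(* (Q(ladder_inv n), ..., Q(1)) *)
Definition ladder_Qseq w (n : nat) : seq pmeas :=
  [seq ladder_Q w k | k <- rev (iota 1 (ladder_inv w n))].

End SpineProcess.

Arguments stick R : clear implicits.
Arguments Omega R : clear implicits.
Arguments nzpmeas R : clear implicits.
Arguments pmeas_seq R : clear implicits.

(* Main.v *)
Require Import Defs.
From HB Require Import structures.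
From mathcomp Require Import all_boot all_order all_algebra finmap multiset.
From mathcomp Require Import boolp classical_sets reals interval_inference.
From mathcomp Require Import zify.

Set Implicit Arguments.
Unset Strict Implicit.
Unset Printing Implicit Defensive.

(** Read backwards from time n, the sticks form a path S whose first step is the
    last stick added, so going from n to n + 1 puts one stick in front of S.

    The right-hand side is computed by cutting S at its first passage above 0:
    the stick crossed there leaves the last entry, and the path beyond is read
    in the same way ([ladder_QseqE]). Cutting at the first passage above a level
    l instead gives a family of sequences, [passage_Qseq], which behaves simply
    under a shift of the path ([passage_Qseq_shift]).

    If the stick in front carries a nonzero measure nu, then S crosses 0 at its
    first step with zeta = 0, so the new sequence is the old one with nu
    appended, as for the spine. If the stick in front carries no atom, then S
    first steps down to -1, and climbing back to 0 means that the old path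
    reaches level 1: the new sequence is the old path cut at level 1 instead of
    0. It remains to see that this is the pruning done by [Phi]
    ([val_Phi_mset0]). The old path gains |Q(k)| - 1 from T(k-1) to T(k), hence
    it first reaches 1 at the first T(k) with |Q(k)| >= 2; the entries before
    that one are skipped, and measuring the overshoot from level 1 rather than 0
    removes one more atom from Q(k). *)

Import Order.TTheory GRing.Theory Num.Theory.

Local Open Scope ring_scope.

(** * Infima and maxima of sets of naturals *)

Variant nat_inf_spec (P : pred nat) : option nat -> Prop :=
  | NatInfSome m of P m & (forall k, P k -> (m <= k)%N) :
      nat_inf_spec P (Some m)
  | NatInfNone of (forall k, ~~ P k) : nat_inf_spec P None.

Lemma nat_infP (P : pred nat) : nat_inf_spec P (nat_inf P).
Proof.
rewrite /nat_inf; case: pselect => [exP | noP].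
  by case: ex_minnP => m Pm min_m; constructor.
by constructor=> k; apply/negP => Pk; apply: noP; exists k.
Qed.

Lemma nat_inf_Some (P : pred nat) m :
  P m -> (forall k, P k -> (m <= k)%N) -> nat_inf P = Some m.
Proof.
move=> Pm min_m; case: nat_infP => [m' Pm' min_m' | noP].
  by congr Some; apply/eqP; rewrite eqn_leq min_m' // min_m.
by have := noP m; rewrite Pm.
Qed.

Lemma nat_inf_None (P : pred nat) : (forall k, ~~ P k) -> nat_inf P = None.
Proof. by move=> noP; case: nat_infP => [m Pm _ | //]; have := noP m; rewrite Pm. Qed.

Lemma nat_inf_shift (P Q : pred nat) t :
  (forall k, P k -> (t <= k)%N) -> (forall k, P (t + k)%N = Q k) ->
  nat_inf P = omap (addn t) (nat_inf Q).
Proof.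
move=> ge_t PQ; case: (nat_infP Q) => [m Qm min_m | noQ] /=.
  apply: nat_inf_Some => [|k Pk]; first by rewrite PQ.
  by have le_tk := ge_t k Pk; rewrite -leq_subRL ?min_m // -PQ subnKC.
apply: nat_inf_None => k; apply/negP => Pk.
by have := noQ (k - t)%N; rewrite -PQ subnKC ?ge_t // Pk.
Qed.

Lemma nat_max_Some (P : pred nat) m :
  P m -> (forall k, P k -> (k <= m)%N) -> nat_max P = Some m.
Proof.
move=> Pm max_m; rewrite /nat_max; case: pselect => [exP | []]; last by exists m.
case: (cid exP) => m' [Pm' max_m'] /=.
by congr Some; apply/eqP; rewrite eqn_leq max_m // max_m'.
Qed.

Lemma nat_max_mem (P : pred nat) m :
  nat_max P = Some m -> P m.
Proof.
rewrite /nat_max; case: pselect => // exP [<-].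
by case: (cid exP) => m' [].
Qed.

Local Arguments luka : simpl never.

Section SpineLadder.
Variable R : realType.
Local Notation pmeas := {mset {posnum R}}%mset.
Implicit Types (w : Omega R) (y : nzpmeas R) (nu : pmeas) (Y : pmeas_seq R) (n t l : nat).

(** * Removing the largest atoms *)

Lemma size_Upsilon k nu : size (Upsilon k nu) = (size nu - k)%N.
Proof. by rewrite (perm_size (perm_eq_seq_mset _)) size_drop size_sort. Qed.

Lemma Upsilon0 nu : Upsilon 0 nu = nu.
Proof.
rewrite /Upsilon drop0; apply/msetP => x.
by rewrite -!count_mem_mset (permP (perm_eq_seq_mset _)) count_sort.
Qed.

(** [Upsilon k nu] keeps a final segment of the decreasing enumeration of nu, and
    this segment is its own decreasing enumeration. *)
Lemma UpsilonD j k nu : Upsilon j (Upsilon k nu) = Upsilon (j + k) nu.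
Proof.
rewrite /Upsilon -/(Upsilon k nu) -drop_drop; congr (seq_mset (drop j _)).
have ->: sort >=%R (Upsilon k nu) = sort >=%R (drop k (sort >=%R nu)).
  apply/perm_sortP; [exact: ge_total | exact: ge_trans | exact: ge_anti |].
  exact: perm_eq_seq_mset.
by rewrite sorted_sort ?drop_sorted ?sort_sorted //; [exact: ge_trans | exact: ge_total].
Qed.

(** * Shifting the path *)

Lemma thetaD (s t : nat) w : theta s%:Z (theta t%:Z w) = theta (t + s)%N%:Z w.
Proof. by apply/funext => k; rewrite /theta PoszD addrA. Qed.

Lemma theta0 w : theta 0 w = w.
Proof. by apply/funext => k; rewrite /theta add0r. Qed.

Lemma vartheta0S n w : vartheta n.+1%:Z w 0%N%:Z = w n.
Proof. by rewrite /vartheta; congr (w _); lia. Qed.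

Lemma theta1_vartheta n w : theta 1%N%:Z (vartheta n.+1%:Z w) = vartheta n%:Z w.
Proof. by apply/funext => k; rewrite /vartheta /theta; congr (w _); lia. Qed.

Lemma luka0 w : luka w 0%N%:Z = 0.
Proof. by rewrite /luka big_geq. Qed.

Lemma lukaS w n : luka w n.+1%:Z = luka w n%:Z + ((size (stick_P w n%:Z))%:Z - 1).
Proof. by rewrite /luka big_nat_recr. Qed.

Lemma lukaD w t n :
  luka w (t + n)%N%:Z = luka w t%:Z + luka (theta t%:Z w) n%:Z.
Proof.
elim: n => [|n IHn]; first by rewrite addn0 luka0 addr0.
by rewrite addnS !lukaS IHn -addrA /stick_P /theta PoszD.
Qed.

(** * First passage times *)

Lemma tau_Some w l t : tau w l = Some t ->
  [/\ (0 < t)%N, l%:Z <= luka w t%:Z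
    & forall j, (0 < j < t)%N -> luka w j%:Z < l%:Z].
Proof.
rewrite /tau; case: nat_infP => // m /= /andP[m_gt0 le_l] min_m [<-].
split=> // j /andP[j_gt0 lt_jm]; rewrite ltNge; apply/negP => le_lj.
by have := min_m j; rewrite /= j_gt0 le_lj leqNgt lt_jm => /(_ isT).
Qed.

(** The path is at most l just before the passage, so zeta is the nonnegative
    integer l - S(t), and S(t+1) - l + 1 atoms of the crossed stick remain. *)
Lemma mu_Some w l t : tau w l = Some t.+1 ->
  [/\ luka w t%:Z <= l%:Z,
      mu w l = Upsilon `|l%:Z - luka w t%:Z|%N (stick_P w t%:Z)
    & (size (mu w l))%:Z = luka w t.+1%:Z - l%:Z + 1].
Proof.
move=> tau_t; have [_ le_l lt_l] := tau_Some tau_t.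
have le_tl : luka w t%:Z <= l%:Z.
  by case: t {tau_t le_l} lt_l => [|t] lt_l; [rewrite luka0 | apply/ltW/lt_l/andP].
have muE : mu w l = Upsilon `|l%:Z - luka w t%:Z|%N (stick_P w t%:Z).
  by rewrite /mu tau_t /zeta -addn1 PoszD addrK.
split=> //; rewrite muE size_Upsilon.
by move: le_l le_tl; rewrite lukaS; set x := luka _ _; lia.
Qed.

Lemma size_mu w l t : tau w l = Some t ->
  (size (mu w l))%:Z = luka w t%:Z - l%:Z + 1.
Proof.
move=> tau_t; have [t_gt0 _ _] := tau_Some tau_t.
by move: tau_t; rewrite -(prednK t_gt0) => /mu_Some[].
Qed.

(** If the path stays below l up to time t, its first passage above l is that of
    the path restarted at t, with l measured from the height reached there. *)
Lemma first_passage_shift w (t l l' : nat) :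
  (forall j, (0 < j <= t)%N -> luka w j%:Z < l%:Z) ->
  l%:Z = luka w t%:Z + l'%:Z ->
  tau w l = omap (addn t) (tau (theta t%:Z w) l') /\
  mu w l = mu (theta t%:Z w) l'.
Proof.
move=> lt_l def_l.
have tauE : tau w l = omap (addn t) (tau (theta t%:Z w) l').
  apply: nat_inf_shift => k /=.
    case/andP=> k_gt0 le_lk; rewrite leqNgt; apply/negP => lt_kt.
    by have := lt_l k; rewrite k_gt0 ltnW // ltNge le_lk => /(_ isT).
  rewrite lukaD def_l lerD2l; case: k => [|k]; last by rewrite addnS.
  (* The index 0 is excluded on the right by the constraint k > 0, and the index
     t > 0 on the left because the path is still below l there. *)
  rewrite addn0 luka0; case: t lt_l def_l => // t lt_l def_l /=.
  have := lt_l t.+1; rewrite def_l ltrDl leqnn => /(_ isT).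
  by rewrite ltNge => /negbTE.
split=> //; rewrite /mu tauE.
case def_s: (tau (theta t%:Z w) l') => [s|] //=.
have [s_gt0 _ _] := tau_Some def_s.
rewrite -(prednK s_gt0) addnS /zeta -[in RHS]addn1 -[in LHS]addn1 !PoszD !addrK.
by rewrite -PoszD lukaD def_l opprD addrACA subrr add0r.
Qed.

(** * Ladder times as iterated first passage times *)

Lemma ladder1 w : ladder w 1 = tau w 0.
Proof. by rewrite /= luka0. Qed.

Lemma ladder_tau_None w k : tau w 0 = None -> ladder w k.+1 = None.
Proof.
move=> tau0; elim: k => [|k IHk]; first by rewrite ladder1.
by rewrite [LHS]/= -/(ladder w k.+1) IHk.
Qed.

(** Ladder times are a recursion at the far end of the path; this unfolds them
    from the near end, which is where the dual path grows. *)
Lemma ladder_theta w t k : tau w 0 = Some t ->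
  ladder w k.+1 = omap (addn t) (ladder (theta t%:Z w) k).
Proof.
move=> tau0; elim: k => [|k IHk]; first by rewrite ladder1 tau0 /= addn0.
rewrite [LHS]/= -/(ladder w k.+1) IHk [in RHS]/=.
case: (ladder (theta _ w) k) => [s|] //=.
apply: nat_inf_shift => j /=; last by rewrite ltn_add2l !lukaD lerD2l.
by case/andP=> /ltnW le_tsj _; apply: leq_trans le_tsj; apply: leq_addr.
Qed.

Lemma leq_ladder w k t : ladder w k = Some t -> (k <= t)%N.
Proof.
elim: k t => // k IHk t; rewrite [ladder _ _]/=.
case: (ladder w k) IHk => // s IHk; case: nat_infP => // m /= /andP[lt_sm _] _ [<-].
exact: leq_ltn_trans (IHk _ erefl) lt_sm.
Qed.

Definition ladder_before w n : pred nat :=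
  [pred k | if ladder w k is Some t then (t <= n)%N else false].

Lemma ladder_before_leq w n k : ladder_before w n k -> (k <= n)%N.
Proof.
rewrite /ladder_before /=; case: (ladder w k) (@leq_ladder w k) => [t|] // /(_ t erefl).
exact: leq_trans.
Qed.

Lemma ladder_invP w n :
  ladder_before w n (ladder_inv w n) /\
  forall k, ladder_before w n k -> (k <= ladder_inv w n)%N.
Proof.
have exP : exists k, ladder_before w n k by exists 0%N.
case: (ex_maxnP exP (@ladder_before_leq w n)) => m Pm max_m.
by rewrite /ladder_inv (nat_max_Some (P := ladder_before w n) Pm max_m).
Qed.

Lemma ladder_inv_eq w n m : ladder_before w n m ->
  (forall k, ladder_before w n k -> (k <= m)%N) -> ladder_inv w n = m.
Proof.
move=> Pm max_m; have [Pi max_i] := ladder_invP w n.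
by apply/eqP; rewrite eqn_leq max_m // max_i.
Qed.

Lemma ladder_inv_theta w t n : tau w 0 = Some t ->
  ladder_inv w (t + n) = (ladder_inv (theta t%:Z w) n).+1.
Proof.
move=> tau0; have [Pi max_i] := ladder_invP (theta t%:Z w) n.
have beforeS k : ladder_before w (t + n) k.+1 = ladder_before (theta t%:Z w) n k.
  rewrite /ladder_before inE (ladder_theta _ tau0) inE.
  by case: (ladder (theta _ w) k) => //= s; rewrite leq_add2l.
apply: ladder_inv_eq => [|[|k]] //; first by rewrite beforeS.
by rewrite beforeS; apply: max_i.
Qed.

Lemma ladder_inv_eq0 w n :
  (forall t, tau w 0 = Some t -> (n < t)%N) -> ladder_inv w n = 0%N.
Proof.
move=> gt_n; apply: ladder_inv_eq => // -[|k] //; rewrite /ladder_before inE.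
case tau0: (tau w 0) gt_n => [t|] gt_n; last by rewrite ladder_tau_None.
rewrite (ladder_theta _ tau0); case: (ladder _ k) => //= s le_tsn.
by have := leq_trans (gt_n t erefl) (leq_trans (leq_addr s t) le_tsn); rewrite ltnn.
Qed.

Lemma ladder_Q1 w : ladder_Q w 1 = mu w 0.
Proof. by rewrite /ladder_Q /= theta0. Qed.

Lemma ladder_QS w t k : tau w 0 = Some t ->
  ladder_Q w k.+2 = ladder_Q (theta t%:Z w) k.+1.
Proof.
move=> tau0; rewrite /ladder_Q (ladder_theta _ tau0) [k.+1.-1]/=.
by case: (ladder (theta _ w) k) => //= s; rewrite thetaD.
Qed.

(** * The ladder sequence behind the first passage above a level *)

(** The ladder sequence up to time n with its first cut at level l. It is
    [ladder_Qseq] for l = 0, and for l = 1 it is the ladder sequence up to time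
    n + 1 of the path preceded by a step -1. *)
Definition passage_Qseq w n l : seq pmeas :=
  if tau w l is Some t then
    if (t <= n)%N then rcons (ladder_Qseq (theta t%:Z w) (n - t)) (mu w l) else [::]
  else [::].

Lemma ladder_QseqE w n : ladder_Qseq w n = passage_Qseq w n 0.
Proof.
rewrite /passage_Qseq; case tau0: (tau w 0) => [t|]; last first.
  by rewrite /ladder_Qseq ladder_inv_eq0 // tau0.
case: leqP => [le_tn | lt_nt]; last first.
  by rewrite /ladder_Qseq ladder_inv_eq0 // => s; rewrite tau0 => -[<-].
rewrite -{1}(subnKC le_tn) /ladder_Qseq (ladder_inv_theta _ tau0).
set m := ladder_inv _ _; rewrite /= rev_cons map_rcons ladder_Q1; congr rcons.
rewrite !map_rev (iotaDl 1 1) -map_comp; congr rev; apply/eq_in_map => -[|k].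
  by rewrite mem_iota.
by move=> _ /=; rewrite (ladder_QS _ tau0).
Qed.

Lemma passage_Qseq_shift w (t n l l' : nat) :
  (forall j, (0 < j <= t)%N -> luka w j%:Z < l%:Z) ->
  l%:Z = luka w t%:Z + l'%:Z ->
  passage_Qseq w (t + n) l = passage_Qseq (theta t%:Z w) n l'.
Proof.
move=> lt_l def_l; have [tauE muE] := first_passage_shift lt_l def_l.
rewrite /passage_Qseq tauE muE; case: (tau (theta _ w) l') => //= s.
by rewrite leq_add2l subnDl thetaD.
Qed.

(** * The spine operator *)

Lemma val_to_seq nu :
  [seq val x | x <- to_seq nu] = if nu != mset0 then [:: nu] else [::].
Proof. by rewrite /to_seq /=; case: insubP => [x -> /= -> | /negbTE ->]. Qed.

Lemma val_Phi_neq0 Y nu : nu != mset0 ->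
  [seq val x | x <- Phi Y nu] = rcons [seq val x | x <- Y] nu.
Proof. by move=> nu_neq0; rewrite /Phi nu_neq0 map_cat val_to_seq nu_neq0 cats1. Qed.

Lemma entry_rcons Y y k : (1 <= k <= size Y)%N -> entry (rcons Y y) k = entry Y k.
Proof.
case/andP=> k_gt0 le_kY; rewrite /entry map_rcons nth_rcons size_map.
by rewrite prednK // le_kY.
Qed.

Lemma entry_rcons_last Y y : entry (rcons Y y) (size Y).+1 = val y.
Proof. by rewrite /entry map_rcons nth_rcons size_map ltnn eqxx. Qed.

Definition big_entry Y : pred nat :=
  [pred k | (1 <= k <= size Y)%N && (2 <= size (entry Y k))%N].

Lemma big_entry_rcons Y y : (size (val y) < 2)%N ->
  big_entry (rcons Y y) = big_entry Y.
Proof.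
move=> small_y; apply/funext => k; rewrite /big_entry /= size_rcons.
have [le_kY | lt_Yk] := leqP k (size Y).
  by rewrite (leqW le_kY) !andbT; case: k le_kY => // k le_kY; rewrite entry_rcons.
rewrite andbF /=; case: (ltngtP k (size Y).+1) => [||->]; rewrite ?andbF //.
  by rewrite ltnS leqNgt lt_Yk.
by rewrite entry_rcons_last (leqNgt 2) small_y andbF.
Qed.

Lemma Phi_rcons_big Y y : (1 < size (val y))%N ->
  Phi (rcons Y y) mset0 = Y ++ to_seq (Upsilon 1 (val y)).
Proof.
move=> big_y; rewrite /Phi eqxx /height (nat_max_Some (m := (size Y).+1)) /=.
- by rewrite -cats1 take_size_cat // cats1 entry_rcons_last.
- by rewrite size_rcons leqnn entry_rcons_last.
- by move=> k /andP[/andP[_]]; rewrite size_rcons.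
Qed.

Lemma Phi_rcons_small Y y : (size (val y) < 2)%N ->
  Phi (rcons Y y) mset0 = Phi Y mset0.
Proof.
move=> small_y; rewrite /Phi eqxx /height -!/(big_entry _) big_entry_rcons //.
case def_h: (nat_max _) => [h|] //.
have /andP[h_le _] := nat_max_mem def_h.
rewrite entry_rcons // -cats1 takel_cat //.
by case/andP: h_le => _; apply: leq_trans; apply: leq_pred.
Qed.

(** Follow the path from one weak ladder time to the next. If the entry Q met
    there has at least two atoms, the path is at |Q| - 1 >= 1, so the passages
    above 0 and 1 coincide and zeta is larger by one for level 1. If Q has one
    atom, the path is back at 0: [Phi] skips Q, and level 1 is still to be
    reached by the path restarted there. *)
Lemma val_Phi_mset0 n w Y : [seq val x | x <- Y] = ladder_Qseq w n ->
  [seq val x | x <- Phi Y mset0] = passage_Qseq w n 1.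
Proof.
elim/ltn_ind: n w Y => n IHn w Y; rewrite ladder_QseqE /passage_Qseq.
have Phi_nil : Phi [::] mset0 = [::] :> pmeas_seq R.
  rewrite /Phi eqxx /height; case def_h: (nat_max _) => [h|] //.
  by have := nat_max_mem def_h => /=; case: h {def_h}.
have tau1_ge t : tau w 1 = Some t -> exists2 s, tau w 0 = Some s & (s <= t)%N.
  case/tau_Some=> t_gt0 le_1 _; rewrite /tau; case: nat_infP => [s _ min_s | /(_ t)].
    by exists s => //; apply: min_s; rewrite /= t_gt0 (le_trans _ le_1).
  by rewrite /= t_gt0 (le_trans _ le_1).
case tau0: (tau w 0) tau1_ge => [t|] tau1_ge; last first.
  case: Y => // _; rewrite Phi_nil; case: (tau w 1) tau1_ge => // t /(_ _ erefl)[] //.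
case: leqP => [le_tn | lt_nt]; last first.
  case: Y => // _; rewrite Phi_nil; case: (tau w 1) tau1_ge => // s /(_ _ erefl)[_ [<-]].
  by move=> le_ts; rewrite leqNgt (leq_trans lt_nt le_ts).
have [t_gt0 luka_ge0 luka_lt] := tau_Some tau0.
have size_q := size_mu tau0.
case/lastP: Y => [|Y y]; first by case: ladder_Qseq.
rewrite map_rcons => /rcons_inj[defY qE].
have def_y : val y = mu w 0 by [].
(* mu w 0 has S(t) + 1 atoms: the two cases are S(t) >= 1 and S(t) = 0. *)
have [big_y | small_y] := ltnP 1 (size (val y)).
  have luka_ge1 : 1%N%:Z <= luka w t%:Z by rewrite def_y in big_y; lia.
  have tau1 : tau w 1 = Some t.
    apply: nat_inf_Some => [|k /andP[k_gt0 le_1k]]; first by rewrite /= t_gt0.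
    rewrite leqNgt; apply/negP => lt_kt.
    by have := luka_lt k; rewrite k_gt0 lt_kt => /(_ isT); lia.
  have mu1 : mu w 1 = Upsilon 1 (mu w 0).
    move: tau0 tau1; rewrite -(prednK t_gt0) => /mu_Some[le_0 -> _] /mu_Some[_ -> _].
    by rewrite UpsilonD; congr Upsilon; lia.
  rewrite tau1 le_tn mu1 Phi_rcons_big // map_cat val_to_seq defY def_y.
  by rewrite -size_mset_eq0 size_Upsilon -def_y subn_eq0 -ltnNge big_y cats1.
have luka_t : luka w t%:Z = 0 by rewrite def_y in small_y; lia.
rewrite Phi_rcons_small // -/(passage_Qseq w n 1) -[in RHS](subnKC le_tn).
rewrite (@passage_Qseq_shift w t _ 1 1) ?luka_t ?add0r //; last first.
  move=> j /andP[j_gt0]; rewrite leq_eqVlt => /predU1P[-> | lt_jt].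
    by rewrite luka_t.
  by apply: lt_trans (luka_lt j _) _; rewrite ?j_gt0.
by apply: IHn => //; lia.
Qed.

End SpineLadder.

Theorem proposition3p5 (R : realType) (w : Omega R) (n : nat) :
  [seq val nu | nu <- spine w n] = ladder_Qseq (vartheta n%:Z w) n.
Proof.
elim: n => [|n IHn].
  by rewrite /ladder_Qseq ladder_inv_eq0 // => t /tau_Some[].
set w' := vartheta n.+1%:Z w.
have theta_w' : theta 1%N%:Z w' = vartheta n%:Z w by apply: theta1_vartheta.
have P_w' : stick_P w' 0%N%:Z = stick_P w n%:Z by rewrite /w' /stick_P vartheta0S.
have luka1 : luka w' 1%N%:Z = (size (stick_P w n%:Z))%:Z - 1.
  by rewrite lukaS luka0 add0r P_w'.
rewrite ladder_QseqE [spine _ _]/=.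
have [P0 | P_neq0] := eqVneq (stick_P w n%:Z) mset0.
  (* The first step goes to -1: level 0 is level 1 seen from there. *)
  rewrite P0 (val_Phi_mset0 IHn) -theta_w' -[n.+1]add1n.
  symmetry; apply: passage_Qseq_shift; last by rewrite luka1 P0 size_mset0.
  by case=> [|[|j]] //; rewrite luka1 P0 size_mset0.
(* The stick in front has an atom, so the first step is a weak ascent. *)
have tau1 : tau w' 0 = Some 1%N.
  apply: nat_inf_Some => [|k /andP[]] //=.
  by rewrite luka1 subr_ge0; move: P_neq0; rewrite -size_mset_eq0; lia.
have [_ mu1 _] := mu_Some tau1.
rewrite val_Phi_neq0 // IHn /passage_Qseq tau1 /= subn1 /= theta_w' mu1.
by rewrite luka0 subrr Upsilon0 P_w'.
Qed.
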